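(* Let $G$ be an even-linked graph of order $n$. Then $$A(G)=\mathrm{core}(G),\qquad D(G)=V(G)\setminus\mathrm{core}(G),\qquad \mu(G)=\frac{n-1}{2}.$$
   Context: All graphs are finite, simple and undirected. $\mu(G)$ is the maximum size of a matching of $G$, and $\mathrm{core}(G)$ is the intersection of all maximum independent sets of $G$. Gallai--Edmonds sets: $D(G)$ is the set of vertices $v$ such that some maximum matching of $G$ misses $v$; $A(G)$ is the set of vertices $v\notin D(G)$ that are adjacent to some $u\in D(G)$. A graph $G$ is $2$-bicritical if $|N(S)|>|S|$ for every nonempty independent set $S\subseteq V(G)$, where $N(S)=\bigcup_{v\in S}N(v)$. Let $H$ be a subgraph of $G$. An ear with respect to $H$ is an odd-length path whose endpoints lie in $H$ and whose internal vertices are distinct and lie outside $H$. A pendant with respect to $H$ is an odd cycle $D$, vertex-disjoint from $H$, together with a simple path of positive length with one end in $D$ and the other in $H$, all of whose other vertices lie outside both $H$ and $D$. A connected $2$-bicritical graph $G$ with exactly two odd cycles (counted as subgraphs) is an even-linked graph if there is a sequence $G_0,G_1,\dots,G_p=G$ such that $G_0$ is an odd cycle, $G_1$ is obtained from $G_0$ by adding a pendant, $G_i$ is obtained from $G_{i-1}$ by adding an ear for $i=2,\dots,p$, and the path of $G_1$ that connects its two odd cycles has even length. *)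

(* Defs.v *)
From mathcomp Require Import all_boot.

Set Implicit Arguments.
Unset Strict Implicit.
Unset Printing Implicit Defensive.

(* A finite simple graph is a symmetric irreflexive relation e on a finType T;
   edges are represented as two-element sets of vertices. *)

Record subgraph (T : finType) := Subgraph {
  sverts : {set T};
  sedges : {set {set T}}
}.

Section Graph.

Variables (T : finType) (e : rel T).

Definition edges : {set {set T}} :=
  [set f : {set T} | [exists x, exists y, e x y && (f == [set x; y])]].

Definition whole : subgraph T := Subgraph [set: T] edges.

Definition connected : Prop := forall x y : T, connect e x y.

Definition nbhd (S : {set T}) : {set T} := [set y | [exists x in S, e x y]].

Definition independent (S : {set T}) : bool :=
  [forall x in S, forall y in S, ~~ e x y].

Definition max_independent (S : {set T}) : bool :=
  independent S &&
  [forall S' : {set T}, independent S' ==> (#|S'| <= #|S|)].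

Definition core : {set T} :=
  \bigcap_(S : {set T} | max_independent S) S.

Definition matching (M : {set {set T}}) : bool :=
  (M \subset edges) && trivIset M.

Definition matching_number : nat :=
  \max_(M : {set {set T}} | matching M) #|M|.

Definition max_matching (M : {set {set T}}) : bool :=
  matching M && (#|M| == matching_number).

Definition gallai_D : {set T} :=
  [set v | [exists M : {set {set T}}, max_matching M && (v \notin cover M)]].

Definition gallai_A : {set T} :=
  [set v | (v \notin gallai_D) && [exists u in gallai_D, e u v]].

Definition two_bicritical : Prop :=
  forall S : {set T}, S != set0 -> independent S -> #|S| < #|nbhd S|.

Definition subgraph_union (H K : subgraph T) : subgraph T :=
  Subgraph (sverts H :|: sverts K) (sedges H :|: sedges K).

(* The subgraph traced by the walk that visits s in order. *)
Definition walk_subgraph (s : seq T) : subgraph T :=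
  Subgraph [set x in s] [set [set z.1; z.2] | z in zip s (behead s)].

Definition cycle_subgraph (c : seq T) : subgraph T :=
  Subgraph [set x in c] [set [set x; next c x] | x in c].

Definition odd_cycle_seq (c : seq T) : bool :=
  [&& cycle e c, uniq c, 2 < size c & odd (size c)].

Definition is_odd_cycle (C : subgraph T) : Prop :=
  exists2 c : seq T, odd_cycle_seq c & C = cycle_subgraph c.

Definition two_odd_cycles : Prop :=
  exists C1 C2 : subgraph T,
    C1 <> C2 /\ forall C, is_odd_cycle C <-> C = C1 \/ C = C2.

(* The path with ends x, y and internal vertices q has size (rcons q y) edges.
   The ends of an ear are allowed to coincide. *)
Definition ear (H : subgraph T) (x : T) (q : seq T) (y : T) : bool :=
  [&& path e x (rcons q y), odd (size (rcons q y)),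
      x \in sverts H, y \in sverts H,
      uniq q & all (fun z => z \notin sverts H) q].

Definition add_ear (H H' : subgraph T) : Prop :=
  exists (x : T) (q : seq T) (y : T),
    ear H x q y /\ H' = subgraph_union H (walk_subgraph (x :: rcons q y)).

Definition pendant (H : subgraph T) (c : seq T) (x : T) (q : seq T) (y : T)
    : bool :=
  [&& odd_cycle_seq c, all (fun z => z \notin sverts H) c,
      path e x (rcons q y), uniq (x :: rcons q y),
      x \in c, y \in sverts H &
      all (fun z => (z \notin sverts H) && (z \notin c)) q].

Definition add_even_pendant (H H' : subgraph T) : Prop :=
  exists (c : seq T) (x : T) (q : seq T) (y : T),
    [/\ pendant H c x q y,
        ~~ odd (size (rcons q y)) &
        H' = subgraph_union H
               (subgraph_union (cycle_subgraph c)
                               (walk_subgraph (x :: rcons q y)))].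

Definition even_linked : Prop :=
  [/\ connected, two_bicritical, two_odd_cycles &
      exists (p : nat) (G : nat -> subgraph T),
        [/\ 0 < p, G p = whole, is_odd_cycle (G 0), add_even_pendant (G 0) (G 1) &
            forall i : nat, 1 < i <= p -> add_ear (G i.-1) (G i)]].

End Graph.

(* Main.v *)
Require Import Defs.
From mathcomp Require Import all_boot all_order all_algebra zify.

(* Once the pendant is attached, the graph consists of two disjoint odd cycles
   c1, c2 and a bipartite graph with sides X, Y, meeting c1 and c2 exactly in
   y and x respectively, where x, y lie in X because the connecting path is
   even.  Two vertices that are not on opposite sides are joined by a simple
   path of even length, so an ear between them would close up to a third odd
   cycle; hence every ear joins X to Y, and the shape persists with
   |X| = |Y| + 1.  Removing any vertex outside Y leaves a perfect matching,
   while a matching has at most (|c1|-1)/2 + (|c2|-1)/2 edges inside the two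
   cycles and all its other edges meet Y; so D is the complement of Y and
   A = Y.  By 2-bicriticality an independent set has at most (n-1)/2 vertices.
   The union of Y with either colour class of the 2-coloured paths c1 - y and
   c2 - x attains this bound, so the core lies in Y.  Conversely, a maximum
   independent set S missing a vertex of Y would contain at least |Y - S|
   vertices of X - {x, y}, all of whose neighbours lie in Y - S, against
   2-bicriticality. *)

Set Implicit Arguments.
Unset Strict Implicit.
Unset Printing Implicit Defensive.

Section Graph.

Variables (T : finType) (e : rel T).
Hypotheses (e_sym : symmetric e) (e_irr : irreflexive e).

(** * Simple paths of prescribed parity *)

(* The path is simple and r = true means odd length. *)
Definition parity_path (V : {set T}) (a b : T) (r : bool) : Prop :=
  exists s, [/\ path e a s, last a s = b, uniq (a :: s),
                {subset a :: s <= V} & odd (size s) = r].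

Lemma parity_path_sub (V W : {set T}) a b r :
  V \subset W -> parity_path V a b r -> parity_path W a b r.
Proof.
by move=> /subsetP sVW [s [? ? ? sV ?]]; exists s; split=> // z /sV /sVW.
Qed.

Lemma path_rev_sym x s : path e x s -> path e (last x s) (rev (belast x s)).
Proof. by move=> h; rewrite rev_path (@eq_path _ _ e) // => a b; rewrite e_sym. Qed.

Lemma parity_path_sym V a b r : parity_path V a b r -> parity_path V b a r.
Proof.
case=> s [ps <- us sV os]; exists (rev (belast a s)).
have E : last a s :: rev (belast a s) = rev (a :: s).
  by rewrite (lastI a s) rev_rcons.
split.
- exact: path_rev_sym.
- by case: s {ps us sV os E} => //= c s; rewrite rev_cons last_rcons.
- by rewrite E rev_uniq.
- by move=> z; rewrite E mem_rev; apply: sV.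
- by rewrite size_rev size_belast.
Qed.

Lemma parity_path_cat (V W : {set T}) a v b r1 r2 : V :&: W \subset [set v] ->
  parity_path V a v r1 -> parity_path W v b r2 ->
  parity_path (V :|: W) a b (r1 (+) r2).
Proof.
move=> /subsetP VW [s [ps ls us sV os]] [t [pt lt ut tW ot]].
exists (s ++ t); split.
- by rewrite cat_path ps ls.
- by rewrite last_cat ls.
- rewrite -cat_cons cat_uniq us /=; move: ut => /= /andP[vt ->]; rewrite andbT.
  apply/hasPn => z zt; apply/negP => zs.
  have : z \in [set v].
    by apply: VW; rewrite inE (sV z zs) tW // inE zt orbT.
  by rewrite inE => /eqP zv; rewrite -zv zt in vt.
- move=> z; rewrite -cat_cons mem_cat => /orP[zs|zt]; rewrite inE.
    by rewrite (sV z zs).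
  by rewrite (tW z) ?orbT // inE zt orbT.
- by rewrite size_cat oddD os ot.
Qed.

(** The two arcs between [v] and [b] have lengths with odd sum, so one of them has parity [r]. *)
Lemma cycle_parity_path c v b r :
  odd_cycle_seq e c -> v \in c -> b \in c -> v != b ->
  parity_path [set z in c] v b r.
Proof.
case/and4P=> cc uc _ oc vc; case: (rot_to vc) => i s E bc vb.
have mE z : (z \in c) = (z \in v :: s) by rewrite -E mem_rot.
move: cc uc oc; rewrite -(rot_cycle i) -(rot_uniq i) -(size_rot i) E.
rewrite /cycle => pc uc oc.
have : b \in s by move: bc; rewrite mE inE eq_sym (negbTE vb).
move=> bs; case/splitPr: bs mE pc uc oc E => s1 s2 mE pc uc oc _.
have first : parity_path [set z in c] v b (~~ odd (size s1)).
  exists (rcons s1 b); split.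
  - by move: pc; rewrite -cat_rcons rcons_cat cat_path => /andP[].
  - by rewrite last_rcons.
  - by move: uc; rewrite -cat_rcons -cat_cons cat_uniq => /andP[].
  - move=> z zz; rewrite inE mE -cat_rcons -cat_cons mem_cat.
    by rewrite zz.
  - by rewrite size_rcons.
have second : parity_path [set z in c] b v (~~ odd (size s2)).
  exists (rcons s2 v); split.
  - by move: pc; rewrite rcons_cat cat_path /= => /and3P[].
  - by rewrite last_rcons.
  - rewrite -rcons_cons rcons_uniq.
    move: uc; rewrite cons_uniq cat_uniq mem_cat negb_or.
    by case/andP => /andP[_ ->] /and3P[].
  - move=> z; rewrite -rcons_cons mem_rcons => zz; rewrite inE mE.
    by move: zz; rewrite !inE mem_cat !inE => /or3P[] ->; rewrite ?orbT.
  - by rewrite size_rcons.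
have [<-|rE] := eqVneq (~~ odd (size s1)) r; first by [].
have <- : ~~ odd (size s2) = r; last exact: parity_path_sym.
move: oc rE; rewrite /= size_cat /= addnS /= negbK oddD.
by case: (odd _); case: (odd _); case: r.
Qed.

(* X and Y are the colour classes; vertices outside X :|: Y are uncoloured.
   A path may have any parity that the colours of its ends do not forbid. *)
Definition parity_rich (V X Y : {set T}) : Prop :=
  forall a b r, a \in V -> b \in V -> a != b ->
    (a \in X :|: Y -> b \in X :|: Y -> r = (a \in X) (+) (b \in X)) ->
    parity_path V a b r.

(** A path from the new vertex [z] to [b] steps to [w] and continues inside [V] with the other
    parity; since [z] gets the colour opposite to [w], the restriction at [z] becomes the one at
    [w]. For [b = w] only odd length can be asked for, and the edge itself serves. *)
Lemma parity_rich_extend (V X Y X' Y' : {set T}) w z :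
  parity_rich V X Y -> w \in V -> w \in X :|: Y -> z \notin V -> e w z ->
  X' :|: Y' = z |: (X :|: Y) -> {in V, X' =i X} -> (z \in X') = ~~ (w \in X) ->
  parity_rich (z |: V) X' Y'.
Proof.
move=> rich wV wB zV ewz B' X'E zX'.
have new b r : b \in V ->
    (b \in X :|: Y -> r = (z \in X') (+) (b \in X)) -> parity_path (z |: V) z b r.
  move=> bV rE.
  have [wb|wb] := eqVneq w b.
    exists [:: b]; rewrite /= -wb e_sym ewz inE; split=> //.
    - by rewrite andbT; apply: contraNneq zV => ->.
    - move=> y; rewrite !inE => /orP[/eqP->|/eqP->]; rewrite ?eqxx ?wV ?orbT //.
    - by rewrite rE -?wb // zX'; case: (w \in X).
  have [s [ps ls us sV os]] : parity_path V w b (~~ r).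
    by apply: rich => // _ bB; rewrite rE // zX'; case: (w \in X); case: (b \in X).
  exists (w :: s); split=> //=.
  - by rewrite e_sym ewz.
  - by move: us => /= ->; rewrite andbT; apply: contra zV => /sV.
  - by move=> y; rewrite !inE => /orP[->//|ys]; rewrite sV ?orbT // inE.
  - by rewrite os negbK.
have inB b : b \in V -> b \in X :|: Y -> b \in X' :|: Y'.
  by move=> _ bB; rewrite B' inE bB orbT.
have zB : z \in X' :|: Y' by rewrite B' !inE eqxx.
move=> a b r az bz ab rE; move: az bz; rewrite !inE.
case/orP => [/eqP az|aV] /orP[/eqP bz|bV].
- by rewrite az bz eqxx in ab.
- rewrite az in rE *; apply: new => // /(inB _ bV) bB.
  by rewrite -X'E // rE.
- rewrite bz in rE *; apply/parity_path_sym/new => // /(inB _ aV) aB.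
  by rewrite -X'E // addbC rE.
- apply: (@parity_path_sub V); first exact: subsetUr.
  apply: rich => // aB bB; rewrite -!X'E //; apply: rE; exact: inB.
Qed.

(** The cycle offers both parities between [v] and any other of its vertices. A path from [V] to
    such a vertex therefore reaches [v] with whatever parity the colours permit and corrects it on
    the cycle. *)
Lemma parity_rich_glue (V X Y : {set T}) v c :
  parity_rich V X Y -> X :|: Y \subset V -> v \in V -> odd_cycle_seq e c ->
  [set z in c] :&: V = [set v] -> parity_rich ([set z in c] :|: V) X Y.
Proof.
move=> rich sBV vV oc cV.
have vc : v \in c by have := set11 v; rewrite -cV !inE => /andP[].
have cVv z : z \in c -> z \in V -> z = v.
  by move=> zc zV; apply/eqP; rewrite -in_set1 -cV !inE zc.
have mixed a b r : a \in V -> a \notin c -> b \in c -> b \notin V ->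
    parity_path ([set z in c] :|: V) a b r.
  move=> aV ac bc bV; pose r1 := (a \in X) (+) (v \in X).
  have -> : r = r1 (+) (r1 (+) r) by rewrite addbA addbb.
  rewrite setUC; apply: (@parity_path_cat _ _ a v).
  - by rewrite setIC cV.
  - by apply: rich => //; apply: contraNneq ac => ->.
  - by apply: cycle_parity_path => //; apply: contraNneq bV => <-.
move=> a b r aW bW ab rE; move: aW bW; rewrite !inE => aW bW.
case: (boolP ((a \in V) && (b \in V))) => [/andP[aV bV]|nV].
  by apply: (@parity_path_sub V); [exact: subsetUr | apply: rich].
case: (boolP ((a \in c) && (b \in c))) => [/andP[ac bc]|nc].
  apply: (@parity_path_sub [set z in c]); first exact: subsetUl.
  exact: cycle_parity_path.
move: aW bW nV nc.
case aV: (a \in V); case bV: (b \in V); rewrite ?orbF ?orbT //= ?andbT.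
- by move=> _ bc _; rewrite bc andbT => ac; apply: mixed; rewrite ?bV.
- by move=> ac _ _; rewrite ac => bc; apply/parity_path_sym/mixed; rewrite ?aV.
- by move=> -> ->.
Qed.


(** * Matchings in paths and odd cycles *)

Lemma edge_in_edges a b : e a b -> [set a; b] \in edges e.
Proof.
move=> eab; rewrite inE; apply/existsP; exists a; apply/existsP; exists b.
by rewrite eab eqxx.
Qed.

Lemma card_edge f : f \in edges e -> #|f| = 2.
Proof.
rewrite inE => /existsP[a /existsP[b /andP[eab /eqP->]]].
by rewrite cards2; case: eqVneq eab => // ->; rewrite e_irr.
Qed.

Lemma matching0 : matching e set0.
Proof. by rewrite /matching sub0set /trivIset /cover !big_set0 cards0. Qed.

Lemma matching1 a b : e a b -> matching e [set [set a; b]].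
Proof. by move=> eab; rewrite /matching sub1set edge_in_edges //= trivIset1. Qed.

Lemma coverU (P Q : {set {set T}}) : cover (P :|: Q) = cover P :|: cover Q.
Proof. exact: bigcup_setU. Qed.

Lemma card_cover_matching M : matching e M -> #|cover M| = #|M|.*2.
Proof.
case/andP => /subsetP sM /eqP <-.
rewrite (eq_bigr (fun=> 2)) => [|f /sM /card_edge //].
by rewrite sum_nat_const muln2.
Qed.

Lemma matchingS (M N : {set {set T}}) : N \subset M -> matching e M -> matching e N.
Proof.
move=> sNM /andP[sM tM]; rewrite /matching (subset_trans sNM sM) /=.
exact: trivIsetS tM.
Qed.

Lemma matchingU (M N : {set {set T}}) (A B : {set T}) :
  matching e M -> matching e N -> cover M \subset A -> cover N \subset B ->
  [disjoint A & B] ->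
  [/\ matching e (M :|: N), cover (M :|: N) \subset A :|: B &
      #|M :|: N| = #|M| + #|N|].
Proof.
move=> mM mN cM cN dAB.
have dMN : [disjoint cover M & cover N] by apply: disjointW dAB.
have mU : matching e (M :|: N).
  case/andP: mM => sM tM; case/andP: mN => sN tN.
  by rewrite /matching subUset sM sN /= trivIsetU.
split; rewrite ?coverU ?setUSS //.
(* Sizes are compared through the covered vertices, twice as many as the edges. *)
apply: double_inj; rewrite doubleD -!card_cover_matching // coverU.
by apply/eqP; rewrite (leq_card_setU _ _).
Qed.

Lemma path_matching s : sorted e s -> uniq s -> ~~ odd (size s) ->
  exists M, [/\ matching e M, cover M \subset [set z in s] & #|M| = (size s)./2].
Proof.
have [n] := ubnP (size s); elim: n s => // n IHn [|a [|b s]] //=.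
  by move=> _ _ _ _; exists set0; rewrite matching0 /cover big_set0 sub0set cards0.
rewrite negbK => lt_sn /andP[eab ps] /and3P[anb bs us] os.
have [||||M [mM cM kM]] := IHn s;
  [exact: ltnW | exact: path_sorted ps | by [] | by [] |].
have [|mU cU kU] := matchingU (matching1 eab) mM (subxx _) cM.
  rewrite disjoints_subset cover1; apply/subsetP => z; rewrite !inE.
  by case/orP => /eqP->; rewrite ?bs //; move: anb; rewrite inE negb_or => /andP[].
exists ([set [set a; b]] :|: M); split=> //.
  apply: subset_trans cU _; apply/subsetP => z; rewrite cover1 !inE.
  by rewrite -orbA.
by rewrite kU kM cards1.
Qed.

(** Deleting [u] leaves a path on an even number of vertices. *)
Lemma cycle_matching c u : odd_cycle_seq e c -> u \in c ->
  exists M, [/\ matching e M, cover M \subset [set z in c] :\ u & #|M| = (size c)./2].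
Proof.
case/and4P => cc uc _ oc /rot_to[i s E].
have mE z : (z \in c) = (z \in u :: s) by rewrite -E mem_rot.
move: cc uc oc; rewrite -(rot_cycle i) -(rot_uniq i) -(size_rot i c) E /=.
rewrite rcons_path => /andP[ps _] /andP[us uns] os.
have [|||M [mM cM kM]] := @path_matching s; [exact: path_sorted ps | by [] | by [] |].
exists M; split=> //; last by rewrite kM uphalf_half (negbTE os).
apply: subset_trans cM _; apply/subsetP => z; rewrite !inE mE inE => zs.
by rewrite zs orbT andbT; apply: contraNneq us => <-.
Qed.

(** * Edges of walks and cycles *)

Definition walk_edges (x : T) (s : seq T) := sedges (walk_subgraph (x :: s)).

Lemma walk_edges_nil x : walk_edges x [::] = set0.
Proof. by apply/setP => f; rewrite !inE; apply/negP => /imsetP[]. Qed.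

Lemma walk_edges_cons x y s :
  walk_edges x (y :: s) = [set x; y] |: walk_edges y s.
Proof.
apply/setP => f; rewrite in_setU1; apply/imsetP/orP => /=.
  case=> z; rewrite inE => /orP[/eqP-> ->|zs ->]; first by left.
  by right; apply/imsetP; exists z.
by case=> [/eqP->|/imsetP[z zs ->]]; [exists (x, y) | exists z];
  rewrite ?inE ?eqxx ?zs ?orbT.
Qed.

Lemma walk_edges_rcons x s z :
  walk_edges x (rcons s z) = [set last x s; z] |: walk_edges x s.
Proof.
elim: s x => [|y s IHs] x; first by rewrite walk_edges_cons !walk_edges_nil.
by rewrite rcons_cons !walk_edges_cons IHs setUCA.
Qed.

Lemma walk_edges_rev x s :
  walk_edges (last x s) (rev (belast x s)) = walk_edges x s.
Proof.
elim: s x => [|y s IHs] x //.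
rewrite [belast _ _]/= rev_cons walk_edges_rcons [last x _]/= IHs.
rewrite walk_edges_cons setUC [in RHS]setUC; congr (_ :|: [set _]).
have -> : last (last y s) (rev (belast y s)) = y.
  by case: (s) => //= z t; rewrite rev_cons last_rcons.
by rewrite setUC.
Qed.

Lemma set2_eq (a b z w : T) :
  [set a; b] = [set z; w] -> (a = z /\ b = w) \/ (a = w /\ b = z).
Proof.
move=> E; have aE : a \in [set z; w] by rewrite -E !inE eqxx.
have bE : b \in [set z; w] by rewrite -E !inE eqxx orbT.
have zE : z \in [set a; b] by rewrite E !inE eqxx.
have wE : w \in [set a; b] by rewrite E !inE eqxx orbT.
move: aE bE zE wE; rewrite !inE.
by do 4![case/orP => /eqP ?]; subst; auto.
Qed.

Lemma cycle_edge_ends (c : seq T) a b : [set a; b] \in sedges (cycle_subgraph c) ->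
  [/\ a \in c, b \in c & b = next c a \/ a = next c b].
Proof.
case/imsetP => z zc /set2_eq.
by case=> [[-> ->]|[-> ->]]; rewrite mem_next zc; split; auto.
Qed.

(** Deleting [u] leaves a path, whose vertices are coloured by the parity of their position. *)
Lemma cycle_two_coloring (c : seq T) u : uniq c -> u \in c ->
  exists p : pred T, forall a b, a != u -> b != u ->
    [set a; b] \in sedges (cycle_subgraph c) -> p a != p b.
Proof.
move=> uc /rot_to[i s E]; exists (fun z => odd (index z s)).
have mE z : (z \in c) = (z \in u :: s) by rewrite -E mem_rot.
have us : uniq (u :: s) by rewrite -E rot_uniq.
have step a : a \in c -> a != u -> next c a != u ->
    odd (index a s) != odd (index (next c a) s).
  move=> ac au; rewrite -(next_rot i) // E next_nth -mE ac /=.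
  rewrite (eq_sym u a) (negbTE au); have [lt|ge] := ltnP (index a s).+1 (size s).
    rewrite index_uniq //=; first by case: odd.
    by case/andP: us.
  (* The last vertex of the path is followed by the default value [u] of [nth], which is
     excluded. *)
  by rewrite nth_default ?eqxx.
move=> a b au bu /cycle_edge_ends[ac bc [bE|aE]].
  by rewrite bE; apply: step => //; rewrite -bE.
by rewrite eq_sym aE; apply: step => //; rewrite -aE.
Qed.

(** The successor map of the cycle sends its vertices in [S] injectively to vertices outside [S]. *)
Lemma cycle_independent c S : odd_cycle_seq e c -> independent e S ->
  #|S :&: [set z in c]| <= (size c)./2.
Proof.
case/and4P => cc uc _ oc /forall_inP iS.
have sub : next c @: (S :&: [set z in c]) \subset [set z in c] :\: S.
  apply/subsetP => w /imsetP[z /setIP[zS]]; rewrite !inE => zc ->.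
  rewrite mem_next zc andbT; apply/negP => nS.
  by have /forall_inP/(_ _ nS) := iS _ zS; rewrite next_cycle.
have := subset_leq_card sub.
rewrite card_imset; last by apply: can_inj (prev_next uc).
have cE : #|[set z in c]| = size c by rewrite cardsE (card_uniqP uc).
have := cardsID S [set z in c]; rewrite setIC cE.
have := odd_double_half (size c); rewrite oc -muln2; lia.
Qed.

(** * Balanced bipartite graphs grown along even paths *)

Definition bichromatic (X Y f : {set T}) : Prop :=
  exists a b, [/\ a \in X, b \in Y & f = [set a; b]].

Lemma bichromaticS (X Y X' Y' f : {set T}) :
  X \subset X' -> Y \subset Y' -> bichromatic X Y f -> bichromatic X' Y' f.
Proof.
move=> /subsetP sX /subsetP sY [a [b [aX bY ->]]].
by exists a, b; split; auto.
Qed.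

(** Used when |X| = |Y| + 1: then [#|Y|] edges avoiding [u] cover every other vertex of
    [X :|: Y]. *)
Definition near_perfect (X Y : {set T}) : Prop :=
  forall u, u \in X -> exists M : {set {set T}},
    [/\ matching e M, cover M \subset (X :|: Y) :\ u & #|M| = #|Y|].

(** [V] may also hold uncoloured cycle vertices. The matchings concern only [X :|: Y], while the
    parity paths may run through all of [V]. *)
Record balanced (V X Y : {set T}) : Prop := Balanced {
  balanced_sub : X :|: Y \subset V;
  balanced_disjoint : [disjoint X & Y];
  balanced_card : #|X| = #|Y|.+1;
  balanced_near_perfect : near_perfect X Y;
  balanced_rich : parity_rich V X Y
}.

Lemma balanced1 u : balanced [set u] [set u] set0.
Proof.
split.
- by rewrite setU0.
- by rewrite disjoint_sym disjoints_subset sub0set.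
- by rewrite cards0 cards1.
- move=> v _; exists set0.
  by rewrite matching0 /cover big_set0 sub0set !cards0.
- by move=> a b r; rewrite !inE => /eqP-> /eqP->; rewrite eqxx.
Qed.

(** Vertices are added in pairs, [a] to [Y] and [b] to [X], which keeps the surplus of one in
    [X]. *)
Lemma balanced_extend V X Y u a b : balanced V X Y -> u \in X -> e u a -> e a b ->
  a \notin V -> b \notin V -> balanced (b |: (a |: V)) (b |: X) (a |: Y).
Proof.
case=> sBV dXY cXY np rich uX eua eab aV bV.
have [sX sY] : X \subset V /\ Y \subset V by apply/andP; rewrite -subUset.
have aX := contra (subsetP sX a) aV; have aY := contra (subsetP sY a) aV.
have bX := contra (subsetP sX b) bV; have bY := contra (subsetP sY b) bV.
have ab : b != a by apply: contraTneq eab => ->; rewrite e_irr.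
have uV := subsetP sX u uX.
split.
- rewrite !subUset !sub1set !inE !eqxx !orbT /=.
  rewrite (subset_trans sX) ?(subset_trans sY) //.
    by rewrite setUA subsetUr.
  by rewrite setUA subsetUr.
- rewrite disjoints_subset; apply/subsetP => z; rewrite !inE negb_or.
  case/orP => [/eqP->|zX]; first by rewrite ab bY.
  rewrite (disjointFr dXY zX) andbT; by apply: contraNneq aX => <-.
- by rewrite !cardsU1 aY bX cXY.
- move=> v; rewrite in_setU1 => vX'.
  (* The edge [c d] is added to an old matching missing [w]. To miss [b], take [w = u] and the edge
     [u a]; to miss an old [v], take [w = v] and the edge [a b]. *)
  have [c [d [w [wX ecd sub dis]]]] : exists c d w, [/\ w \in X, e c d,
     ((X :|: Y) :\ w) :|: [set c; d] \subset ((b |: X) :|: (a |: Y)) :\ v &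
     [disjoint (X :|: Y) :\ w & [set c; d]]].
    case/orP: vX' => [/eqP->|vX].
      exists u, a, u; split=> //.
        apply/subsetP => z; rewrite !inE => /orP[/andP[zu zB]|].
          rewrite orbCA -orbA zB !orbT andbT.
          by case/orP: zB => zB; [apply: contraNneq bX|apply: contraNneq bY] => <-.
        case/orP => /eqP->; rewrite ?uX ?eqxx ?orbT ?andbT //.
          by apply: contraNneq bX => <-.
        by rewrite eq_sym.
      rewrite disjoints_subset; apply/subsetP => z; rewrite !inE negb_or.
      case/andP => -> /=; by apply: contraTneq => ->; rewrite negb_or aX.
    exists a, b, v; split=> //.
      apply/subsetP => z; rewrite !inE => /orP[/andP[-> /=]|].
        by case/orP => ->; rewrite ?orbT.
      case/orP => /eqP->; rewrite ?eqxx ?orbT ?andbT //.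
        by apply: contraNneq aX => ->.
      by apply: contraNneq bX => ->.
    rewrite disjoints_subset; apply/subsetP => z; rewrite !inE negb_or.
    case/andP => _ zB; apply/andP; split; move: zB; apply: contraTneq => ->.
      by rewrite negb_or aX.
    by rewrite negb_or bX.
  have [M [mM cM kM]] := np w wX.
  have [|mU cU kU] := matchingU mM (matching1 ecd) cM _ dis.
    by rewrite cover1.
  exists (M :|: [set [set c; d]]); split=> //; first exact: subset_trans cU sub.
  by rewrite kU kM cards1 cardsU1 aY addnC.
(* Two one-vertex extensions: [a] is attached to [u], then [b] to [a]. *)
- apply: (@parity_rich_extend _ X (a |: Y) _ _ a).
  + apply: (@parity_rich_extend _ X Y _ _ u) => //; first by rewrite inE uX.
      by rewrite setUCA.
    by rewrite uX (negbTE aX).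
  + by rewrite !inE eqxx.
  + by rewrite !inE eqxx orbT.
  + by rewrite !inE negb_or ab.
  + by [].
  + exact/esym/setUA.
  + move=> z; rewrite !inE => /orP[/eqP->|zV]; first by rewrite eq_sym (negbTE ab).
    by case: eqVneq => // zb; rewrite -zb zV in bV.
  + by rewrite !inE eqxx (negbTE aX).
Qed.

(** Induction two vertices at a time: the new vertices go alternately to [Y] and [X], and even
    length brings the last one into [X]. *)
Lemma balanced_path V X Y u s : balanced V X Y -> u \in X -> path e u s ->
  ~~ odd (size s) -> uniq s -> all (fun z => z \notin V) s ->
  exists X' Y', [/\ balanced (V :|: [set z in s]) X' Y', X \subset X', Y \subset Y',
    X' :|: Y' = X :|: Y :|: [set z in s] /\ last u s \in X' &
    forall f, f \in walk_edges u s -> bichromatic X' Y' f].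
Proof.
have [n] := ubnP (size s).
elim: n s u V X Y => // n IHn [|a [|b s]] u V X Y //= lt_sn snd uX.
  move=> _ _ _ _; exists X, Y.
  have -> : [set z in [::]] = set0 :> {set T} by apply/setP => z; rewrite !inE.
  rewrite !setU0; split=> // f.
  by rewrite walk_edges_nil inE.
case/and3P => eua eab pbs; rewrite negbK => os /and3P[anb bs us] /and3P[aV bV sV].
have snd' := balanced_extend snd uX eua eab aV bV.
have [|||X' [Y' [snd2 sX sY [BE lX] wE]]] :=
    IHn s b _ _ _ _ snd' _ pbs os us _.
- exact: ltnW.
- by rewrite !inE eqxx.
- apply/allP => z zs; rewrite !inE !negb_or (allP sV z zs) andbT.
  apply/andP; split; first by apply: contraNneq bs => <-.
  by apply: contraNneq anb => <-; rewrite inE zs orbT.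
move: sX sY; rewrite !subUset !sub1set => /andP[bX sX] /andP[aY sY].
exists X', Y'; split=> //.
- have -> : V :|: [set z in [:: a, b & s]] = b |: (a |: V) :|: [set z in s] => //.
  by apply/setP => z; rewrite !inE; do !case: eqP => //=; rewrite ?orbT.
- split=> //; rewrite BE; apply/setP => z; rewrite !inE.
  by do !case: eqP => //=; rewrite ?orbT.
- move=> f; rewrite !walk_edges_cons !in_setU1 => /or3P[/eqP->|/eqP->|/wE //].
    by exists u, a; rewrite aY (subsetP sX).
  by exists b, a; rewrite aY bX setUC.
Qed.

Lemma balanced_glue V X Y v c : balanced V X Y -> v \in X :|: Y ->
  odd_cycle_seq e c -> [set z in c] :&: V = [set v] ->
  balanced ([set z in c] :|: V) X Y.
Proof.
case=> sBV dXY cXY np rich vB oc cV; split=> //.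
  by apply: subset_trans sBV (subsetUr _ _).
exact: (parity_rich_glue rich sBV (subsetP sBV v vB) oc cV).
Qed.

(** * Two odd cycles linked by a balanced bipartite graph *)

(** The shape kept along the ear construction. The last two fields serve to recognise a one-edge ear
    that closes up to [c1] or [c2] as an old edge of [H]. *)
Record linked (c1 c2 : seq T) (x y : T) (H : subgraph T) (X Y : {set T}) : Prop :=
  Linked {
    linked_balanced : balanced (sverts H) X Y;
    linked_x : x \in X;
    linked_y : y \in X;
    linked_verts : sverts H = X :|: Y :|: [set z in c1] :|: [set z in c2];
    linked_c1 : [set z in c1] :&: (X :|: Y) = [set y];
    linked_c2 : [set z in c2] :&: (X :|: Y) = [set x];
    linked_edges : forall f, f \in sedges H -> [\/ bichromatic X Y f,
      f \in sedges (cycle_subgraph c1) | f \in sedges (cycle_subgraph c2)];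
    linked_edges1 : sedges (cycle_subgraph c1) \subset sedges H;
    linked_edges2 : sedges (cycle_subgraph c2) \subset sedges H
  }.

(** Start from the single vertex [y], glue [c1] there, follow the connecting path back from [y] to
    [x], and glue [c2] at [x]. *)
Lemma even_pendant_linked c1 H : odd_cycle_seq e c1 ->
  add_even_pendant e (cycle_subgraph c1) H ->
  exists c2 x y X Y, [/\ odd_cycle_seq e c2,
    [disjoint [set z in c1] & [set z in c2]] & linked c1 c2 x y H X Y].
Proof.
move=> oc1 [c2 [x [q [y [pend os ->]]]]].
case/and5P: pend => oc2 c2c1 pxy uxy /and3P[xc2 yc1 qout].
have c21 z : z \in c2 -> z \notin c1.
  by move=> zc; have := allP c2c1 z zc; rewrite inE.
have yc : y \in c1 by move: yc1; rewrite inE.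
have snd0 : balanced [set z in c1] [set y] set0.
  have -> : [set z in c1] = [set z in c1] :|: [set y].
    by apply/esym/setUidPl; rewrite sub1set inE.
  apply: (balanced_glue (v := y)) => //; rewrite ?inE ?eqxx //; first exact: balanced1.
  by apply/setIidPr; rewrite sub1set inE.
(* The connecting path read from [y], without [y] itself: it has as many vertices as the path has
   edges, an even number, so [x] lands in [X]. *)
pose s := rev (x :: q).
have sE : s = rev (belast x (rcons q y)) by rewrite belast_rcons.
have ps : path e y s by have := path_rev_sym pxy; rewrite last_rcons -sE.
have zsE z : (z \in s) = (z == x) || (z \in q) by rewrite mem_rev inE.
have qc1 z : z \in q -> z \notin c1.
  by move=> zq; have /andP[] := allP qout z zq; rewrite inE.
have qc2 z : z \in q -> z \notin c2 by move=> zq; have /andP[] := allP qout z zq.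
have sc1 z : z \in s -> z \notin c1.
  by rewrite zsE => /orP[/eqP->|/qc1 //]; apply: c21.
have [|||X [Y [snd sX _ [BE lX] wE]]] := balanced_path snd0 (set11 y) ps.
- by rewrite size_rev; move: os; rewrite size_rcons.
- by rewrite rev_uniq; move: uxy; rewrite -rcons_cons rcons_uniq => /andP[].
- by apply/allP => z zs; rewrite inE sc1.
have wsE : walk_edges y s = walk_edges x (rcons q y).
  by have := walk_edges_rev x (rcons q y); rewrite last_rcons -sE.
rewrite wsE in wE.
have xX : x \in X by move: lX; rewrite /s rev_cons last_rcons.
have yX : y \in X by rewrite -sub1set.
have Bz z : (z \in X :|: Y) = (z == y) || (z \in s) by rewrite BE !inE orbF.
have B1 : [set z in c1] :&: (X :|: Y) = [set y].
  apply/setP => z; rewrite in_setI Bz !inE.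
  case: eqVneq => [->|_] /=; first by rewrite yc.
  by apply/negP => /andP[zc /sc1]; rewrite zc.
have B2 : [set z in c2] :&: (X :|: Y) = [set x].
  apply/setP => z; rewrite in_setI Bz !inE zsE.
  case: (eqVneq z x) => [->|_] /=; first by rewrite xc2 orbT.
  apply/negP => /andP[zc /orP[/eqP zy|/qc2]]; last by rewrite zc.
  by move: (c21 z zc); rewrite zy yc.
have oV : [set z in c2] :&: ([set z in c1] :|: [set z in s]) = [set x].
  rewrite -B2; apply/setP => z; rewrite !in_setI Bz !inE.
  case zc2: (z \in c2) => //=; rewrite (negbTE (c21 _ zc2)) /=.
  by case: eqVneq => // zy; move: (c21 z zc2); rewrite zy yc.
have xB : x \in X :|: Y by rewrite inE xX.
have snd' := balanced_glue snd xB oc2 oV.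
exists c2, x, y, X, Y; split=> //.
  rewrite disjoints_subset; apply/subsetP => z; rewrite !inE.
  by apply: contraL; apply: c21.
have vE : [set z in c1] :|: ([set z in c2] :|: [set z in x :: rcons q y]) =
    [set z in c2] :|: ([set z in c1] :|: [set z in s]).
  apply/setP => z; rewrite !inE mem_rcons inE zsE.
  case: (eqVneq z y) => [->|_] /=; first by rewrite yc !orbT.
  by case: (z \in c1); case: (z \in c2); case: (z == x); case: (z \in q).
split=> //=.
- by rewrite vE.
- rewrite vE; apply/setP => z; rewrite in_setU [RHS]in_setU [in RHS]in_setU Bz !inE.
  case: (eqVneq z y) => [->|_] /=; first by rewrite yc !orbT.
  by case: (z \in c1); case: (z \in c2); case: (z \in s).
- move=> f; rewrite !in_setU => /or3P[? | ? | /wE ?].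
  + exact: Or32.
  + exact: Or33.
  + exact: Or31.
- exact: subsetUl.
- by rewrite setUCA subsetUl.
Qed.

Lemma third_odd_cycle c1 c2 c : two_odd_cycles e ->
  odd_cycle_seq e c1 -> odd_cycle_seq e c2 ->
  [disjoint [set z in c1] & [set z in c2]] -> odd_cycle_seq e c ->
  cycle_subgraph c = cycle_subgraph c1 \/ cycle_subgraph c = cycle_subgraph c2.
Proof.
move=> [C1 [C2 [_ only]]] oc1 oc2 d12 oc.
have c12 : cycle_subgraph c1 <> cycle_subgraph c2.
  case=> E _; move: d12; rewrite E -setI_eq0 setIid => /eqP/setP.
  by case/and4P: oc2; case: (c2) => // a s _ _ _ _ /(_ a); rewrite !inE eqxx.
have [] := (only _).1 (ex_intro2 _ _ c oc erefl);
have [] := (only _).1 (ex_intro2 _ _ c1 oc1 erefl);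
have [] := (only _).1 (ex_intro2 _ _ c2 oc2 erefl); intuition congruence.
Qed.

(** If the ends are not on opposite sides, an even simple path inside [H] closes the ear to an odd
    cycle. This must be [c1] or [c2], which lie in [H], so the ear is a single edge already
    present. *)
Lemma ear_ends c1 c2 x y H X Y a q b : two_odd_cycles e ->
  odd_cycle_seq e c1 -> odd_cycle_seq e c2 ->
  [disjoint [set z in c1] & [set z in c2]] -> linked c1 c2 x y H X Y ->
  ear e H a q b ->
  [\/ q = [::] /\ [set a; b] \in sedges H, a \in X /\ b \in Y | a \in Y /\ b \in X].
Proof.
move=> two oc1 oc2 d12 lk /and5P[pq oq aH bH /andP[uq qH]].
have [sBV dXY _ _ rich] := linked_balanced lk.
case: (boolP ((a \in X) && (b \in Y))) => [/andP[]|nXY]; first by constructor 2.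
case: (boolP ((a \in Y) && (b \in X))) => [/andP[]|nYX]; first by constructor 3.
constructor 1.
have [s [ps ls us sV es]] : parity_path (sverts H) a b false.
  (* An ear with equal ends is itself closed, and the empty path serves. *)
  have [<-|ab] := eqVneq a b.
    by exists [::]; split=> // z; rewrite inE => /eqP->.
  apply: rich => //; rewrite !inE.
  move: nXY nYX; case aX: (a \in X); case bX: (b \in X); rewrite ?andbT //=.
  - by move=> /negbTE->.
  - by move=> _ /negbTE->.
have qV z : z \in q -> z \notin sverts H by move=> zq; apply: (allP qH).
have prq : path e b (rcons (rev q) a).
  by have := path_rev_sym pq; rewrite last_rcons belast_rcons rev_cons.
have oc : odd_cycle_seq e (a :: s ++ rev q).
  apply/and4P; split.
  - by rewrite /= rcons_cat cat_path ps ls.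
  - rewrite -cat_cons cat_uniq us rev_uniq uq andbT /=.
    apply/hasPn => z; rewrite mem_rev => zq; apply/negP => /sV zV.
    by move: (qV z zq); rewrite zV.
  - rewrite /= size_cat size_rev.
    (* Both sizes are even, and they do not both vanish since there are no loops; hence the cycle
       has at least three vertices. *)
    have : size s + size q != 0.
      rewrite addn_eq0; apply/negP => /andP[/nilP s0 /nilP q0].
      by move: pq ls; rewrite s0 q0 /= => /andP[eab _] ab; rewrite ab e_irr in eab.
    move: oq es; rewrite size_rcons /=.
    by case: (size s) => [|[|k]]; case: (size q) => [|[|m]].
  - by move: oq; rewrite /= size_cat size_rev size_rcons /= oddD es.
have [C [CE sVC sEC]] : exists C, [/\ cycle_subgraph (a :: s ++ rev q) = C,
    sverts C \subset sverts H & sedges C \subset sedges H].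
  have vE := linked_verts lk.
  case: (third_odd_cycle two oc1 oc2 d12 oc) => ->.
    exists (cycle_subgraph c1); split=> //; last exact: linked_edges1 lk.
    by rewrite vE -setUA setUCA subsetUl.
  exists (cycle_subgraph c2); split=> //; last exact: linked_edges2 lk.
  by rewrite vE subsetUr.
have q0 : q = [::].
  case: (q) qV CE => // z q' qV CE; case/negP: (qV z (mem_head _ _)).
  apply: (subsetP sVC); rewrite -CE inE inE mem_cat mem_rev inE eqxx.
  by rewrite !orbT.
split=> //; apply: (subsetP sEC); rewrite -CE q0 cats0.
(* [b] ends the cycle sequence, so [next] wraps around to [a], the default of [nth]. *)
have las : last a s \in a :: s by apply: mem_last.
apply/imsetP; exists b; first by rewrite -ls.
by rewrite next_nth -ls las index_last // nth_default // setUC.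
Qed.

(** The internal vertices of the ear, even in number, are absorbed from its end in [X]; the last of
    them is again in [X'], so the closing edge to [w] is bichromatic. *)
Lemma linked_ear c1 c2 x y H H' X Y u s w : linked c1 c2 x y H X Y ->
  u \in X -> w \in Y -> path e u (rcons s w) -> odd (size (rcons s w)) ->
  uniq s -> all (fun z => z \notin sverts H) s ->
  sverts H' = sverts H :|: [set z in s] ->
  sedges H' = sedges H :|: walk_edges u (rcons s w) ->
  exists X' Y', linked c1 c2 x y H' X' Y'.
Proof.
case=> snd xX yX vE B1 B2 eE E1 E2 uX wY.
rewrite rcons_path => /andP[ps _]; rewrite size_rcons /= => os us sH vE' eE'.
have [X' [Y' [snd' sX sY [BE lX] wE]]] := balanced_path snd uX ps os us sH.
(* The new vertices lie outside [H], so the attachment vertices of the cycles do not change. *)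
have cs c : [set z in c] \subset sverts H ->
    [set z in c] :&: (X' :|: Y') = [set z in c] :&: (X :|: Y).
  move=> /subsetP cH; rewrite BE setIUr; apply/setUidPl/subsetP => z.
  rewrite in_setI => /andP[/cH zH]; rewrite inE => /(allP sH).
  by rewrite zH.
exists X', Y'; split.
- by rewrite vE'.
- exact: (subsetP sX).
- exact: (subsetP sX).
- rewrite vE' BE vE; apply/setP => z; rewrite !inE.
  by case: (z \in X); case: (z \in Y); case: (z \in c1); case: (z \in s);
    rewrite ?orbT ?orbF.
- by rewrite cs ?B1 // vE -setUA setUCA subsetUl.
- by rewrite cs ?B2 // vE subsetUr.
- move=> f; rewrite eE' walk_edges_rcons !in_setU in_set1.
  case/or3P => [/eE[h|h|h]|/eqP->|/wE h].
  + by constructor 1; apply: bichromaticS h.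
  + by constructor 2.
  + by constructor 3.
  + by constructor 1; exists (last u s), w; split=> //; apply: (subsetP sY).
  + by constructor 1.
- by rewrite eE'; apply: subset_trans E1 (subsetUl _ _).
- by rewrite eE'; apply: subset_trans E2 (subsetUl _ _).
Qed.

Lemma linked_add_ear c1 c2 x y H H' X Y : two_odd_cycles e ->
  odd_cycle_seq e c1 -> odd_cycle_seq e c2 ->
  [disjoint [set z in c1] & [set z in c2]] -> linked c1 c2 x y H X Y ->
  add_ear e H H' -> exists X' Y', linked c1 c2 x y H' X' Y'.
Proof.
move=> two oc1 oc2 d12 lk [a [q [b [ear_q ->]]]].
have ends := ear_ends two oc1 oc2 d12 lk ear_q.
case/and5P: ear_q => pq oq aH bH /andP[uq qH].
have vE : sverts H :|: [set z in a :: rcons q b] = sverts H :|: [set z in q].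
  apply/setP => z; rewrite !inE mem_rcons inE.
  case: (eqVneq z a) => [->|_]; first by rewrite aH.
  by case: (eqVneq z b) => [->|_]; first by rewrite bH.
case: ends => [[q0 abH]|[aX bY]|[aY bX]].
(* The ear repeats an edge of [H] and adds nothing. *)
- exists X, Y; suff -> : subgraph_union H (walk_subgraph (a :: rcons q b)) = H.
    by [].
  rewrite /subgraph_union /= vE q0.
  have -> : [set z in [::]] = set0 :> {set T} by apply/setP => z; rewrite !inE.
  rewrite setU0; move: (walk_edges_cons a b [::]); rewrite walk_edges_nil setU0.
  rewrite /walk_edges /= => ->; have /setUidPl -> : [set [set a; b]] \subset sedges H.
    by rewrite sub1set.
  by case: (H).
- exact: (linked_ear lk aX bY pq oq uq qH).
(* The ear is reversed so as to start in [X]. *)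
- apply: (linked_ear lk bX aY (s := rev q)).
  + by have := path_rev_sym pq; rewrite last_rcons belast_rcons rev_cons.
  + by move: oq; rewrite !size_rcons size_rev.
  + by rewrite rev_uniq.
  + by rewrite all_rev.
  + by rewrite /= vE; congr (_ :|: _); apply/setP => z; rewrite !inE mem_rev.
  + rewrite /=; congr (_ :|: _); have := walk_edges_rev a (rcons q b).
    by rewrite last_rcons belast_rcons rev_cons.
Qed.

Lemma even_linked_structure : even_linked e ->
  exists c1 c2 x y X Y, [/\ odd_cycle_seq e c1, odd_cycle_seq e c2,
    [disjoint [set z in c1] & [set z in c2]] & linked c1 c2 x y (whole e) X Y].
Proof.
case=> _ _ two [p [G [p0 Gp [c1 oc1 G0] G1 Gi]]].
rewrite G0 in G1.
have [c2 [x [y [X [Y [oc2 d12 lk]]]]]] := even_pendant_linked oc1 G1.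
have all_linked i : 0 < i <= p -> exists X' Y', linked c1 c2 x y (G i) X' Y'.
  elim: i => [|[|i] IHi] //; first by exists X, Y.
  move=> ip; have [|X' [Y' lk']] := IHi; first by move: ip => /andP[_ /ltnW].
  exact: (linked_add_ear two oc1 oc2 d12 lk' (Gi i.+2 ip)).
have [|X' [Y' lk']] := all_linked p; first by rewrite p0 leqnn.
by exists c1, c2, x, y, X', Y'; split=> //; rewrite -Gp.
Qed.

(** * Order, matchings and Gallai-Edmonds sets of the linked graph *)

Section Structure.

Variables (c1 c2 : seq T) (x y : T) (X Y : {set T}).
Hypotheses (oc1 : odd_cycle_seq e c1) (oc2 : odd_cycle_seq e c2).
Hypothesis d12 : [disjoint [set z in c1] & [set z in c2]].
Hypothesis lk : linked c1 c2 x y (whole e) X Y.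
Hypothesis bicrit : two_bicritical e.

(** This number turns out to be (n-1)/2, the matching number and the independence number. *)
Let k := #|Y| + (size c1)./2 + (size c2)./2.

Let xX : x \in X := linked_x lk.
Let yX : y \in X := linked_y lk.
Let dXY : [disjoint X & Y] := balanced_disjoint (linked_balanced lk).

Lemma in_c1_coloured z : (z \in c1) && (z \in X :|: Y) = (z == y).
Proof. by rewrite -in_set1 -(linked_c1 lk) in_setI [in RHS]inE. Qed.

Lemma in_c2_coloured z : (z \in c2) && (z \in X :|: Y) = (z == x).
Proof. by rewrite -in_set1 -(linked_c2 lk) in_setI [in RHS]inE. Qed.

Lemma y_in_c1 : y \in c1.
Proof. by have := in_c1_coloured y; rewrite eqxx => /andP[]. Qed.

Lemma x_in_c2 : x \in c2.
Proof. by have := in_c2_coloured x; rewrite eqxx => /andP[]. Qed.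

Lemma disjoint_cycles z : z \in c1 -> z \in c2 -> False.
Proof.
move=> z1 z2; have := disjointFr d12 (x := z).
by rewrite !inE z1 z2 => /(_ isT).
Qed.

Lemma all_verts z : [|| z \in X, z \in Y, z \in c1 | z \in c2].
Proof.
have := in_setT z; rewrite -[setT]/(sverts (whole e)) (linked_verts lk) !inE.
by rewrite -!orbA.
Qed.

Lemma edge_cases a b : e a b ->
  [\/ a \in X /\ b \in Y, a \in Y /\ b \in X,
      [set a; b] \in sedges (cycle_subgraph c1) |
      [set a; b] \in sedges (cycle_subgraph c2)].
Proof.
move=> /edge_in_edges /(linked_edges lk)[[a' [b' [aX bY E]]]|?|?].
- by case: (set2_eq E) => [[-> ->]|[-> ->]]; [constructor 1 | constructor 2].
- by constructor 3.
- by constructor 4.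
Qed.

Lemma c1_notin_Y z : z \in c1 -> z \notin Y.
Proof.
move=> zc; apply/negP => zY; have := in_c1_coloured z.
rewrite zc inE zY orbT => /esym/eqP zy.
by have := disjointFr dXY yX; rewrite -zy zY.
Qed.

Lemma c2_notin_Y z : z \in c2 -> z \notin Y.
Proof.
move=> zc; apply/negP => zY; have := in_c2_coloured z.
rewrite zc inE zY orbT => /esym/eqP zx.
by have := disjointFr dXY xX; rewrite -zx zY.
Qed.

Lemma nbr_Y a b : a \in Y -> e a b -> b \in X.
Proof.
move=> aY /edge_cases[[aX _]|[_ //]|/cycle_edge_ends[ac _ _]|/cycle_edge_ends[ac _ _]].
- by rewrite (disjointFr dXY aX) in aY.
- by rewrite (negbTE (c1_notin_Y ac)) in aY.
- by rewrite (negbTE (c2_notin_Y ac)) in aY.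
Qed.

Lemma nbr_X a b : a \in X -> a != x -> a != y -> e a b -> b \in Y.
Proof.
move=> aX ax ay.
case/edge_cases=> [[_ //]|[aY]|/cycle_edge_ends[ac _ _]|/cycle_edge_ends[ac _ _]].
- by rewrite (disjointFr dXY aX) in aY.
- by have := in_c1_coloured a; rewrite ac inE aX (negbTE ay).
- by have := in_c2_coloured a; rewrite ac inE aX (negbTE ax).
Qed.

(** [X :|: Y] has 2|Y| + 1 vertices, and each cycle adds all its vertices but one. *)
Lemma order_linked : #|T| = k.*2.+1.
Proof.
have oh (c : seq T) : odd_cycle_seq e c -> #|[set z in c]| = (size c)./2.*2.+1.
  case/and4P=> _ uc _ oc; rewrite cardsE (card_uniqP uc).
  by rewrite -[LHS]odd_double_half oc.
have := cardsUI [set z in c1] (X :|: Y); rewrite (linked_c1 lk) cards1.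
have := cardsUI [set z in c2] (X :|: Y :|: [set z in c1]).
have -> : [set z in c2] :&: (X :|: Y :|: [set z in c1]) = [set x].
  by rewrite setIUr (linked_c2 lk) setIC (eqP (etrans (setI_eq0 _ _) d12)) setU0.
rewrite cards1 setUC -(linked_verts lk) /= cardsT.
have := cardsUI X Y; rewrite (eqP (etrans (setI_eq0 _ _) dXY)) cards0.
rewrite (setUC [set z in c1]) (oh _ oc1) (oh _ oc2).
rewrite (balanced_card (linked_balanced lk)) /k -!muln2 !addn0 => ->.
move: (size c1)./2 (size c2)./2 #|Y| #|T| #|_ :|: _| => m1 m2 n t w; lia.
Qed.

(** Each edge lies inside [c1], lies inside [c2] or meets [Y]. Counting only the covered part of [Y]
    lets the same bound show that maximum matchings cover [Y]. *)
Lemma matching_bound M : matching e M ->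
  #|M| <= (size c1)./2 + (size c2)./2 + #|cover M :&: Y|.
Proof.
move=> mM; have [/subsetP sM tM] := andP mM.
have inside c : odd_cycle_seq e c -> #|M ::&: [set z in c]| <= (size c)./2.
  case/and4P => _ uc _ oc.
  have mN : matching e (M ::&: [set z in c]).
    by apply: matchingS mM; apply/subsetP => f; rewrite inE => /andP[].
  have := subset_leq_card (subset_trans (cover_setI M [set z in c]) (subsetIr _ _)).
  have cE : #|[set z in c]| = size c by rewrite cardsE (card_uniqP uc).
  rewrite card_cover_matching // cE.
  by move=> /half_leq; rewrite doubleK.
(* Sending a covered vertex of [Y] to its matching edge reaches every edge that meets [Y]. *)
pose M3 := pblock M @: (cover M :&: Y).
have sub : M \subset (M ::&: [set z in c1]) :|: (M ::&: [set z in c2]) :|: M3.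
  apply/subsetP => f fM; rewrite !in_setU.
  have cyc c : f \in sedges (cycle_subgraph c) -> f \in M ::&: [set z in c].
    case/imsetP => z zc fE; rewrite inE fM /= fE.
    by apply/subsetP => w; rewrite !inE => /orP[] /eqP->; rewrite ?mem_next.
  case: (linked_edges lk (sM f fM)) => [[a [b [aX bY fE]]]|/cyc ->|/cyc ->];
    rewrite ?orbT //.
  apply/orP; right; apply/imsetP; exists b.
    rewrite inE bY andbT; apply/bigcupP; exists f => //.
    by rewrite fE !inE eqxx orbT.
  by apply/esym/def_pblock => //; rewrite fE !inE eqxx orbT.
apply: leq_trans (subset_leq_card sub) _.
apply: leq_trans (leq_card_setU _ _) _; apply: leq_add (leq_imset_card _ _).
apply: leq_trans (leq_card_setU _ _) _; exact: leq_add (inside _ oc1) (inside _ oc2).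
Qed.

Lemma matching_missing v : v \notin Y ->
  exists M, [/\ matching e M, v \notin cover M & #|M| = k].
Proof.
move=> vY.
(* Matchings of [c1] without [u1], [c2] without [u2] and [X :|: Y] without [u] are united. To make
   the pieces disjoint, each of the shared vertices [y] and [x] must be deleted from a piece
   containing it. *)
have glue u1 u2 u : u1 \in c1 -> u2 \in c2 -> u \in X ->
    y \in [:: u1; u] -> x \in [:: u2; u] ->
    v \notin [set z in c1] :\ u1 -> v \notin [set z in c2] :\ u2 ->
    v \notin (X :|: Y) :\ u ->
    exists M, [/\ matching e M, v \notin cover M & #|M| = k].
  move=> u1c u2c uX yu xu v1 v2 v3.
  have [M1 [m1 s1 k1]] := cycle_matching oc1 u1c.
  have [M2 [m2 s2 k2]] := cycle_matching oc2 u2c.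
  have [M3 [m3 s3 k3]] := balanced_near_perfect (linked_balanced lk) uX.
  have [|m13 s13 k13] := matchingU m1 m3 s1 s3.
    rewrite disjoints_subset; apply/subsetP => z /setD1P[zu1]; rewrite inE => zc.
    rewrite in_setC in_setD1; apply/negP => /andP[zu zB].
    have := in_c1_coloured z; rewrite zc zB => /esym/eqP zy.
    by move: yu; rewrite !inE -zy (negbTE zu1) (negbTE zu).
  have [|m s kk] := matchingU m2 m13 s2 s13.
    rewrite disjoints_subset; apply/subsetP => z /setD1P[zu2]; rewrite inE => zc.
    rewrite in_setC in_setU !in_setD1 negb_or; apply/andP; split.
      by apply/negP; rewrite inE => /andP[_ /disjoint_cycles/(_ zc)].
    apply/negP => /andP[zu zB].
    have := in_c2_coloured z; rewrite zc zB => /esym/eqP zx.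
    by move: xu; rewrite !inE -zx (negbTE zu2) (negbTE zu).
  exists (M2 :|: (M1 :|: M3)); split=> //.
    apply/negP => /(subsetP s); rewrite !in_setU.
    by rewrite (negbTE v1) (negbTE v2) (negbTE v3).
  by rewrite kk k13 k1 k2 k3 /k addnC (addnC (size c1)./2).
have vD (A : {set T}) : v \notin A :\ v by rewrite in_setD1 eqxx.
(* If [v] is in [X], the bipartite piece gives up [v] and the cycles give up [y] and [x]. If [v] is
   an uncoloured vertex of a cycle, that cycle gives up [v] and the bipartite piece its attachment
   vertex. *)
case: (boolP (v \in X)) => vX.
  apply: (glue y x v); rewrite ?y_in_c1 ?x_in_c2 ?mem_head ?vD // in_setD1 inE.
    apply/negP => /andP[vy vc]; have := in_c1_coloured v.
    by rewrite vc inE vX (negbTE vy).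
  apply/negP => /andP[vx vc]; have := in_c2_coloured v.
  by rewrite vc inE vX (negbTE vx).
have vB u : v \notin (X :|: Y) :\ u by rewrite !inE (negbTE vX) (negbTE vY) andbF.
have := all_verts v; rewrite (negbTE vX) (negbTE vY) /= => /orP[vc|vc].
  apply: (glue v x y) => //; rewrite ?x_in_c2 ?inE ?eqxx ?orbT //.
  by apply/negP => /andP[_ /(disjoint_cycles vc)].
apply: (glue y v x) => //; rewrite ?y_in_c1 ?inE ?eqxx ?orbT //.
by apply/negP => /andP[_ vc1]; apply: disjoint_cycles vc1 vc.
Qed.

Lemma matching_le M : matching e M -> #|M| <= k.
Proof.
move=> /matching_bound /leq_trans; apply.
by rewrite /k addnC addnA !leq_add2r subset_leq_card // subsetIr.
Qed.

Lemma matching_numberE : matching_number e = k.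
Proof.
have xY : x \notin Y by rewrite (disjointFr dXY xX).
have [M [mM _ kM]] := matching_missing xY.
apply/eqP; rewrite eqn_leq; apply/andP; split.
  by apply/bigmax_leqP => N; apply: matching_le.
by rewrite -kM; apply: (bigmax_sup M).
Qed.

Lemma gallai_DE : gallai_D e = ~: Y.
Proof.
apply/setP => v; rewrite !inE; apply/existsP/idP.
  case=> M /andP[/andP[mM /eqP kM] vM]; apply/negP => vY.
  (* Missing [v] makes the covered part of [Y] a proper subset, so the bound drops below [k]. *)
  have := matching_bound mM; rewrite kM matching_numberE /k.
  rewrite -addnA addnC leq_add2l leqNgt => /negP; apply; apply: proper_card.
  apply/properP; split; first exact: subsetIr.
  by exists v => //; rewrite inE (negbTE vM).
move=> /matching_missing[M [mM vM kM]]; exists M.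
by rewrite /max_matching mM kM matching_numberE eqxx.
Qed.

(** Neighbours of [Y] lie in [X], hence in D; 2-bicriticality applied to a single vertex supplies a
    neighbour. *)
Lemma gallai_AE : gallai_A e = Y.
Proof.
apply/setP => v; rewrite inE gallai_DE inE negbK; case vY: (v \in Y) => //=.
have iv : independent e [set v].
  by apply/forall_inP => a /set1P->; apply/forall_inP => b /set1P->; rewrite e_irr.
have v0 : [set v] != set0 by apply/set0Pn; exists v; rewrite inE.
have := bicrit v0 iv; rewrite cards1 => /ltnW /card_gt0P[w].
rewrite inE => /exists_inP[_ /set1P-> evw]; apply/exists_inP; exists w.
  by rewrite inE (disjointFr dXY (nbr_Y vY evw)).
by rewrite e_sym.
Qed.

(** * Independent sets and the core *)

(** If [S] is nonempty, [nbhd e S] is disjoint from [S] and larger, so 2|S| < n. *)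
Lemma independent_le S : independent e S -> #|S| <= k.
Proof.
move=> iS; have [->|S0] := eqVneq S set0; first by rewrite cards0.
have sub : nbhd e S \subset ~: S.
  apply/subsetP => b; rewrite inE => /exists_inP[a aS eab]; rewrite inE.
  by apply: contraL eab => bS; have /forall_inP/(_ b bS) := forall_inP iS a aS.
have := leq_trans (bicrit S0 iS) (subset_leq_card sub).
have := cardsC S; rewrite order_linked -muln2; clear; lia.
Qed.

Lemma max_independent_pair : exists S1 S2, [/\ max_independent e S1,
  max_independent e S2, #|S1| = k & S1 :&: S2 = Y].
Proof.
have [p1 p1E] : exists p : pred T, forall a b, a != y -> b != y ->
    [set a; b] \in sedges (cycle_subgraph c1) -> p a != p b.
  by apply: cycle_two_coloring y_in_c1; case/and4P: oc1.
have [p2 p2E] : exists p : pred T, forall a b, a != x -> b != x ->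
    [set a; b] \in sedges (cycle_subgraph c2) -> p a != p b.
  by apply: cycle_two_coloring x_in_c2; case/and4P: oc2.
pose p z := if z \in c1 then p1 z else p2 z.
(* [Y] together with one colour class of the cycles without their attachment vertices. *)
pose S r := [set z in ~: X | (z \in Y) || (p z == r)].
have iS r : independent e (S r).
  apply/forall_inP => a; rewrite !inE => /andP[aX ar].
  apply/forall_inP => b; rewrite !inE => /andP[bX br].
  have nxy z : z \notin X -> (z != x) * (z != y).
    by move=> zX; split; apply: contraNneq zX => ->.
  apply/negP => /edge_cases[[]|[]|E|E]; rewrite ?(negbTE aX) ?(negbTE bX) //.
    have [ac bc _] := cycle_edge_ends E.
    have := p1E a b (nxy a aX).2 (nxy b bX).2 E.
    move: ar br; rewrite /p ac bc (negbTE (c1_notin_Y ac)) (negbTE (c1_notin_Y bc)).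
    by move=> /eqP-> /eqP->; rewrite eqxx.
  have [ac bc _] := cycle_edge_ends E.
  have := p2E a b (nxy a aX).1 (nxy b bX).1 E.
  have c1F z : z \in c2 -> z \in c1 = false.
    by move=> z2; apply/negP => /disjoint_cycles; apply.
  move: ar br; rewrite /p !c1F // (negbTE (c2_notin_Y ac)) (negbTE (c2_notin_Y bc)).
  by move=> /eqP-> /eqP->; rewrite eqxx.
have YX z : z \in Y -> z \notin X by move=> zY; rewrite (disjointFl dXY zY).
have SI : S true :&: S false = Y.
  apply/setP => z; rewrite !inE; case zY: (z \in Y); first by rewrite YX.
  by rewrite /=; case: (p z); rewrite ?andbF.
have SU : S true :|: S false = ~: X.
  apply/setP => z; rewrite !inE; case: (z \in X) => //=.
  by case: (z \in Y) => //=; case: (p z).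
(* The union is the complement of [X] and the intersection is [Y], so the two sizes add up to 2k
   while neither exceeds [k]. *)
have kS : #|S true| = k /\ #|S false| = k.
  have := cardsUI (S true) (S false); rewrite SU SI.
  have := independent_le (iS true); have := independent_le (iS false).
  have := cardsC X; rewrite order_linked (balanced_card (linked_balanced lk)) -muln2.
  by clear; lia.
have max r : #|S r| = k -> max_independent e (S r).
  move=> kr; rewrite /max_independent iS /= kr.
  by apply/forallP => S'; apply/implyP/independent_le.
by exists (S true), (S false); split; rewrite ?max ?kS //; case: kS.
Qed.

Lemma coreE : core e = Y.
Proof.
have [S1 [S2 [m1 m2 k1 S12]]] := max_independent_pair.
apply/eqP; rewrite eqEsubset; apply/andP; split.
  by rewrite -S12 subsetI /core !bigcap_inf.
apply/bigcapsP => S /andP[iS /forallP /(_ S1)].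
case/andP: m1 => i1 _; rewrite i1 k1 /= => kS.
have X' z : z \in X :\: [set x; y] -> [/\ z \in X, z != x & z != y].
  by rewrite !inE negb_or => /andP[/andP[]].
(* [x] and [y] are counted on the cycles; every other vertex of [X] has all its neighbours in
   [Y]. *)
pose W := S :&: (X :\: [set x; y]).
have cover : S \subset
    (S :&: [set z in c1]) :|: (S :&: [set z in c2]) :|: W :|: (S :&: Y).
  apply/subsetP => z zS; rewrite 3!in_setU !in_setI zS !inE /=.
  case: (eqVneq z x) => [->|_]; first by rewrite x_in_c2 orbT.
  case: (eqVneq z y) => [->|_]; first by rewrite y_in_c1.
  by move: (all_verts z); case: (z \in X); case: (z \in Y); case: (z \in c1);
    case: (z \in c2).
(* [S] has at least [k] vertices and less than half of each cycle, so [W] makes up for the vertices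
   of [Y] that [S] misses. *)
have YW : #|Y| <= #|W| + #|S :&: Y|.
  have := leq_trans kS (subset_leq_card cover).
  have := leq_card_setU (S :&: [set z in c1] :|: S :&: [set z in c2] :|: W) (S :&: Y).
  have := leq_card_setU (S :&: [set z in c1] :|: S :&: [set z in c2]) W.
  have := leq_card_setU (S :&: [set z in c1]) (S :&: [set z in c2]).
  have := cycle_independent oc1 iS; have := cycle_independent oc2 iS.
  move=> h1 h2 [h3 _] [h4 _] [h5 _]; rewrite /k => h6.
  move: h1 h2 h3 h4 h5 h6; clear; lia.
(* Otherwise |N(W)| <= |Y - S| <= |W| would contradict 2-bicriticality. *)
have W0 : W = set0.
  apply/eqP/negPn/negP => /bicrit bW.
  have iW : independent e W.
    apply/forall_inP => a /setIP[aS _]; apply/forall_inP => b /setIP[bS _].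
    by have /forall_inP/(_ b bS) := forall_inP iS a aS.
  have sub : nbhd e W \subset Y :\: S.
    apply/subsetP => b; rewrite !inE => /exists_inP[a /setIP[aS /X'[aX ax ay]] eab].
    rewrite (nbr_X aX ax ay eab) andbT; apply: contraL eab => bS.
    by have /forall_inP/(_ b bS) := forall_inP iS a aS.
  have := leq_trans (bW iW) (subset_leq_card sub).
  have := cardsID S Y; rewrite setIC; move: YW; clear; lia.
have /eqP <- : S :&: Y == Y; last exact: subsetIl.
by rewrite eqEcard subsetIr /=; move: YW; rewrite W0 cards0.
Qed.

End Structure.

End Graph.

Theorem theorem4p8 (T : finType) (e : rel T)
    (e_sym : symmetric e) (e_irr : irreflexive e) (e_linked : even_linked e) :
  [/\ gallai_A e = core e,
      gallai_D e = [set: T] :\: core e &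
      ((matching_number e)%:R = (#|T|%:R - 1) / 2%:R :> rat)%R].
Proof.
have [c1 [c2 [x [y [X [Y [oc1 oc2 d12 lk]]]]]]] :=
  even_linked_structure e_sym e_irr e_linked.
have bicrit : two_bicritical e by case: e_linked.
have coreY := coreE oc1 oc2 d12 lk bicrit.
split.
- by rewrite coreY (gallai_AE e_sym e_irr oc1 oc2 d12 lk bicrit).
- by rewrite coreY setTD (gallai_DE e_irr oc1 oc2 d12 lk).
- rewrite (matching_numberE e_irr oc1 oc2 d12 lk) (order_linked oc1 oc2 d12 lk).
  move: (#|Y| + _ + _) => m.
  by rewrite -addn1 -muln2 GRing.natrD GRing.natrM GRing.addrK GRing.mulfK.
Qed.
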